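(* Let $\mathcal{V}$ be a semidegenerate congruence-modular variety and let $A\in\mathcal{V}$. Assume that $I=(I_{\ast})^{\ast}$ for every ideal $I$ of $L(A)$ (equivalently, that $P_{\ast}\in Spec(A)$ for every prime ideal $P$ of $L(A)$). Then the maps $u:Spec_Z(A)\rightarrow Spec_{Id,Z}(L(A))$, $u(\phi)=\phi^{\ast}$, and $v:Spec_{Id,Z}(L(A))\rightarrow Spec_Z(A)$, $v(P)=P_{\ast}$, are homeomorphisms, inverse to one another.
   Context: Algebras have a fixed finite signature $\tau$. A variety is semidegenerate if none of its nontrivial algebras has a one-element subalgebra. For $A$ in a semidegenerate congruence-modular variety $\mathcal{V}$, $Con(A)$ is the congruence lattice with least element $\Delta_A$ and greatest element $\nabla_A$; $K(A)$ is the set of compact (= finitely generated) congruences (here $\nabla_A\in K(A)$). $[\cdot,\cdot]$ is the modular commutator of Freese–McKenzie: the greatest operation on congruence lattices of members of $\mathcal{V}$ such that for every surjective morphism $f:A\to B$ and $\alpha,\beta\in Con(A)$, $[\alpha,\beta]_A\subseteq\alpha\cap\beta$ and $[\alpha,\beta]_A\lor Ker(f)=f^{-1}([f(\alpha\lor Ker(f)),f(\beta\lor Ker(f))]_B)$. It is commutative, monotone, distributes over arbitrary joins, and satisfies $[\theta,\nabla_A]=\theta$. A congruence $\phi\neq\nabla_A$ is prime if $[\alpha,\beta]\subseteq\phi$ implies $\alpha\subseteq\phi$ or $\beta\subseteq\phi$, for all $\alpha,\beta\in Con(A)$. $Spec(A)$ is the set of prime congruences; $D(\theta)=\{\phi\in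 Spec(A)\mid\theta\not\subseteq\phi\}$; $Spec_Z(A)$ is $Spec(A)$ with the topology whose open sets are the $D(\theta)$, $\theta\in Con(A)$. The radical is $\rho(\theta)=\bigwedge\{\phi\in Spec(A)\mid\theta\subseteq\phi\}$. $C(A)$ is the smallest subset of $Con(A)$ containing $K(A)$ and closed under binary joins and commutators. For $\alpha,\beta\in C(A)$ put $\alpha\equiv\beta$ iff $\rho(\alpha)=\rho(\beta)$. $L(A)=C(A)/{\equiv}$ is a bounded distributive lattice with join induced by $\lor$, meet induced by $[\cdot,\cdot]$, $0$ = class of $\Delta_A$, $1$ = class of $\nabla_A$; $\lambda_A:C(A)\to L(A)$ is the quotient map. For $\theta\in Con(A)$, $\theta^{\ast}=\{\lambda_A(\alpha)\mid\alpha\in C(A),\alpha\subseteq\theta\}$ (an ideal of $L(A)$); for an ideal $I$ of $L(A)$, $I_{\ast}=\bigvee\{\alpha\in K(A)\mid\lambda_A(\alpha)\in I\}\in Con(A)$. If $\phi\in Spec(A)$ then $\phi^{\ast}$ is a prime ideal. For a bounded distributive lattice $L$, $Spec_{Id,Z}(L)$ is the set of prime ideals of $L$ with the Stone topology, whose open sets are $D_{Id}(I)=\{Q\mid I\not\subseteq Q\}$, $I$ an ideal of $L$. *)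

(* Defs.v *)
From HB Require Import structures.
From mathcomp Require Import all_boot all_order.
From mathcomp Require Import boolp classical_sets functions cardinality.
From mathcomp Require Import topology.

Set Implicit Arguments.
Unset Strict Implicit.
Unset Printing Implicit Defensive.

Import Order.TTheory.

Local Open Scope quotient_scope.
Local Open Scope classical_set_scope.
Local Open Scope order_scope.

Record signature := Signature {
  sym : finType;
  arity : sym -> nat
}.

Record algebra (tau : signature) := Algebra {
  carrier :> Type;
  carrier_inhabited : inhabited carrier;
  op : forall s : sym tau, ('I_(arity s) -> carrier) -> carrier
}.

Arguments op {tau} _ s x.

Section Morphisms.
Context {tau : signature}.

Definition is_hom (A B : algebra tau) (f : A -> B) : Prop :=
  forall (s : sym tau) (x : 'I_(arity s) -> A), f (op A s x) = op B s (f \o x).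

Record epi (A B : algebra tau) := Epi {
  epi_fun :> A -> B;
  epi_hom : is_hom epi_fun;
  epi_surj : forall b, exists a, epi_fun a = b
}.

Definition subuniverse (A : algebra tau) (S : set A) : Prop :=
  forall (s : sym tau) (x : 'I_(arity s) -> A), (forall i, S (x i)) -> S (op A s x).

Definition nontrivial (A : algebra tau) : Prop := exists a b : A, a <> b.

Lemma prod_inhabited (I : Type) (F : I -> algebra tau) :
  inhabited (forall i, F i).
Proof.
have h i : exists _ : F i, True by case: (carrier_inhabited (F i)) => a; exists a.
by constructor=> i; exact: projT1 (cid (h i)).
Qed.

Definition prod_algebra (I : Type) (F : I -> algebra tau) : algebra tau :=
  @Algebra tau (forall i, F i) (prod_inhabited F)
    (fun s x i => op (F i) s (fun k => x k i)).

End Morphisms.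

(* Closure under homomorphic images, subalgebras (up to isomorphism) and products. *)
Record variety (tau : signature) := Variety {
  in_variety : algebra tau -> Prop;
  variety_H : forall (A B : algebra tau) (f : A -> B), is_hom f ->
    (forall b, exists a, f a = b) -> in_variety A -> in_variety B;
  variety_S : forall (A B : algebra tau) (f : A -> B), is_hom f ->
    injective f -> in_variety B -> in_variety A;
  variety_P : forall (I : Type) (F : I -> algebra tau),
    (forall i, in_variety (F i)) -> in_variety (prod_algebra F)
}.

Record member (tau : signature) (V : variety tau) := Member {
  member_algebra :> algebra tau;
  memberP : in_variety V member_algebra
}.

Section Congruences.
Context {tau : signature}.

Record Con (A : algebra tau) := MkCon {
  con_rel :> A -> A -> Prop;
  con_refl : forall x, con_rel x x;
  con_sym : forall x y, con_rel x y -> con_rel y x;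
  con_trans : forall x y z, con_rel x y -> con_rel y z -> con_rel x z;
  con_op : forall (s : sym tau) (x y : 'I_(arity s) -> A),
    (forall i, con_rel (x i) (y i)) -> con_rel (op A s x) (op A s y)
}.

HB.instance Definition _ (A : algebra tau) := gen_eqMixin (Con A).
HB.instance Definition _ (A : algebra tau) := gen_choiceMixin (Con A).

Lemma con_ext (A : algebra tau) (a b : Con A) :
  (forall x y, a x y <-> b x y) -> a = b.
Proof.
case: a b => [a a1 a2 a3 a4] [b b1 b2 b3 b4] /= h.
have e : a = b by apply/funext => x; apply/funext => y; apply/propext.
by move: b1 b2 b3 b4; rewrite -e => b1 b2 b3 b4; congr MkCon; exact: Prop_irrelevance.
Qed.

Section Ops.
Context {A : algebra tau}.

Program Definition con_inf (S : set (Con A)) : Con A :=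
  @MkCon A (fun x y => forall a, S a -> a x y) _ _ _ _.
Next Obligation. by move=> S x a _; exact: con_refl. Qed.
Next Obligation. by move=> S x y h a Sa; apply: con_sym; exact: h. Qed.
Next Obligation. by move=> S x y z h k a Sa; exact: con_trans (h a Sa) (k a Sa). Qed.
Next Obligation. by move=> S s x y h a Sa; apply: con_op => i; exact: h. Qed.

Definition con_gen (X : set (A * A)) : Con A :=
  con_inf [set a | forall x y, X (x, y) -> a x y].

Definition con_sup (S : set (Con A)) : Con A :=
  con_gen [set p | exists2 a, S a & a p.1 p.2].

Program Definition con_Delta : Con A := @MkCon A eq _ _ _ _.
Next Obligation. by []. Qed.
Next Obligation. by []. Qed.
Next Obligation. by move=> x y z -> ->. Qed.
Next Obligation. by move=> s x y h; congr (op A s); apply/funext. Qed.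

Program Definition con_Nabla : Con A := @MkCon A (fun _ _ => True) _ _ _ _.
Solve All Obligations with by [].

Program Definition con_meet (a b : Con A) : Con A :=
  @MkCon A (fun x y => a x y /\ b x y) _ _ _ _.
Next Obligation. by move=> a b x; split; exact: con_refl. Qed.
Next Obligation. by move=> a b x y [h k]; split; exact: con_sym. Qed.
Next Obligation.
by move=> a b x y z [h h'] [k k']; split; [exact: con_trans h k|exact: con_trans h' k'].
Qed.
Next Obligation. by move=> a b s x y h; split; apply: con_op => i; case: (h i). Qed.

Definition con_join (a b : Con A) : Con A :=
  con_gen [set p | a p.1 p.2 \/ b p.1 p.2].

Definition con_le : rel (Con A) := fun a b => `[< forall x y, a x y -> b x y >].

Lemma con_le_refl : reflexive con_le.
Proof. by move=> a; apply/asboolP. Qed.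

Lemma con_le_anti : antisymmetric con_le.
Proof.
move=> a b /andP[/asboolP h /asboolP k].
by apply: con_ext => x y; split; [exact: h|exact: k].
Qed.

Lemma con_le_trans : transitive con_le.
Proof.
by move=> b a c /asboolP h /asboolP k; apply/asboolP => x y /h /k.
Qed.

End Ops.

Fact con_display : Order.disp_t. Proof. exact: Order.Disp tt tt. Qed.

HB.instance Definition _ (A : algebra tau) :=
  Order.Le_isPOrder.Build con_display (Con A)
    con_le_refl con_le_anti con_le_trans.

Section Lattice.
Context {A : algebra tau}.
Implicit Types a b c : Con A.

Lemma leConP a b : reflect (forall x y, a x y -> b x y) (a <= b).
Proof. exact: asboolP. Qed.

Lemma con_gen_le (X : set (A * A)) c :
  con_gen X <= c <-> forall x y, X (x, y) -> c x y.
Proof.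
split=> [/leConP h x y Xxy|h]; first by apply: h => a; exact.
by apply/leConP => x y; exact.
Qed.

Lemma con_meetP a b c : (a <= con_meet b c) = (a <= b) && (a <= c).
Proof.
apply/leConP/andP => [h|[/leConP h /leConP k] x y axy].
  by split; apply/leConP => x y /h[].
by split; [exact: h|exact: k].
Qed.

Lemma con_joinP a b c : (con_join a b <= c) = (a <= c) && (b <= c).
Proof.
apply/idP/andP => [/con_gen_le h|[/leConP h /leConP k]].
  by split; apply/leConP => x y xy; apply: h => /=; [left|right].
by apply/con_gen_le => x y /= [/h|/k].
Qed.

Lemma con_Delta_le a : con_Delta <= a.
Proof. by apply/leConP => x _ <-; exact: con_refl. Qed.

Lemma con_Nabla_ge a : a <= con_Nabla.
Proof. by apply/leConP. Qed.

End Lattice.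

HB.instance Definition _ (A : algebra tau) :=
  Order.POrder_MeetJoin_isLattice.Build con_display (Con A)
    con_meetP con_joinP.
HB.instance Definition _ (A : algebra tau) :=
  Order.hasBottom.Build con_display (Con A) con_Delta_le.
HB.instance Definition _ (A : algebra tau) :=
  Order.hasTop.Build con_display (Con A) con_Nabla_ge.

Lemma con_sup_le (A : algebra tau) (S : set (Con A)) (c : Con A) :
  con_sup S <= c <-> forall a, S a -> a <= c.
Proof.
split=> [/con_gen_le h a Sa|h].
  by apply/leConP => x y axy; apply: h; exists a.
by apply/con_gen_le => x y [a /h /leConP]; exact.
Qed.

Lemma con_sup_ub (A : algebra tau) (S : set (Con A)) (a : Con A) :
  S a -> a <= con_sup S.
Proof. by have /con_sup_le h := lexx (con_sup S); exact: h. Qed.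

(* Compact congruences are the finitely generated ones. *)
Definition compact_con (A : algebra tau) : set (Con A) :=
  [set a | exists2 X : set (A * A), finite_set X & a = con_gen X].

Section Transport.
Context {A B : algebra tau} (f : epi A B).

Program Definition con_preim (b : Con B) : Con A :=
  @MkCon A (fun x y => b (f x) (f y)) _ _ _ _.
Next Obligation. by move=> b x; exact: con_refl. Qed.
Next Obligation. by move=> b x y; exact: con_sym. Qed.
Next Obligation. by move=> b x y z; exact: con_trans. Qed.
Next Obligation. by move=> b s x y h /=; rewrite !(epi_hom f); exact: con_op. Qed.

Definition con_ker : Con A := con_preim \bot.

Lemma con_kerE x y : con_ker x y <-> f x = f y.
Proof. by []. Qed.

(* f(a \/ Ker f): joining with Ker f makes the direct image a congruence. *)
Program Definition con_image (a : Con A) : Con B :=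
  @MkCon B (fun u v => exists x y, [/\ f x = u, f y = v & (a `|` con_ker) x y])
    _ _ _ _.
Next Obligation.
move=> a u; have [x <-] := epi_surj f u.
by exists x, x; split=> //; exact: con_refl.
Qed.
Next Obligation.
by move=> a u v [x [y [ex ey xy]]]; exists y, x; split=> //; exact: con_sym.
Qed.
Next Obligation.
move=> a u v w [x [y [<- ey xy]]] [y' [z [ey' <- yz]]].
exists x, z; split=> //; apply: con_trans xy (con_trans _ yz).
have /leConP := leUr con_ker a; apply; rewrite con_kerE ey; exact: esym.
Qed.
Next Obligation.
move=> a s u v h; pose g i := cid (h i); pose k i := cid (projT2 (g i)).
exists (op A s (fun i => projT1 (g i))), (op A s (fun i => projT1 (k i))).
split; [rewrite (epi_hom f)|rewrite (epi_hom f)|apply: con_op => i].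
- by congr (op B s); apply/funext => i /=; case: (projT2 (k i)).
- by congr (op B s); apply/funext => i /=; case: (projT2 (k i)).
- by case: (projT2 (k i)).
Qed.

Lemma con_preim_image (a : Con A) : con_preim (con_image a) = a `|` con_ker.
Proof.
apply: con_ext => x y; split=> [[x' [y' [ex ey h]]]|h]; last by exists x, y.
have /leConP k := leUr con_ker a.
apply: con_trans (con_trans _ h) _; apply: k; first exact: esym.
exact: ey.
Qed.

Lemma con_image_le (a : Con A) (b : Con B) :
  (con_image a <= b) = (a <= con_preim b).
Proof.
have kb : con_ker <= con_preim b.
  by apply/leConP => x y /con_kerE e; rewrite /= e; exact: con_refl.
have -> : (a <= con_preim b) = (a `|` con_ker <= con_preim b).
  by rewrite leUx kb andbT.
apply/leConP/leConP => [h x y xy|h u v [x [y [<- <- /h]]]//].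
by apply: h; exists x, y.
Qed.

Lemma le_con_image (a : Con A) (b : Con B) :
  con_preim b <= a -> b <= con_image a.
Proof.
move=> /leConP h; apply/leConP => u v.
have [x <-] := epi_surj f u; have [y <-] := epi_surj f v => xy.
exists x, y; split=> //; have /leConP := leUl a con_ker; apply; exact: h.
Qed.

End Transport.

End Congruences.

Section Quotient.
Context {tau : signature} (A : algebra tau) (t : Con A).

Let T := {classic A}.
Let r : rel T := fun x y => `[< t x y >].

Let r_refl : reflexive r.
Proof. by move=> x; apply/asboolP; exact: con_refl. Qed.
Let r_sym : symmetric r.
Proof. by move=> x y; apply/asboolP/asboolP; exact: con_sym. Qed.
Let r_trans : transitive r.
Proof. move=> y x z /asboolP h /asboolP k; apply/asboolP; exact: con_trans h k. Qed.

Let e := EquivRel r r_refl r_sym r_trans.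

Let quo_inhabited : inhabited {eq_quot e}.
Proof.
by case: (carrier_inhabited A) => a; constructor; exact: (\pi_({eq_quot e}) (a : T))%qT.
Qed.

Definition quo_algebra : algebra tau :=
  @Algebra tau {eq_quot e} quo_inhabited
    (fun s x => (\pi_({eq_quot e}) (op A s (fun i => repr (x i)) : T))%qT).

Definition quo_fun (a : A) : quo_algebra := (\pi_({eq_quot e}) (a : T))%qT.

Lemma quo_funP x y : quo_fun x = quo_fun y <-> t x y.
Proof.
by split=> [/eqmodP /asboolP|h]; last by apply/eqmodP/asboolP.
Qed.

Lemma quo_fun_hom : is_hom quo_fun.
Proof.
move=> s x; apply/quo_funP; apply: con_op => i /=.
by apply/quo_funP; rewrite /quo_fun reprK.
Qed.

Lemma quo_fun_surj (b : quo_algebra) : exists a, quo_fun a = b.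
Proof. by exists (repr (b : {eq_quot e})); exact: reprK. Qed.

Definition quo_epi : epi A quo_algebra := Epi quo_fun_hom quo_fun_surj.

End Quotient.

Definition semidegenerate (tau : signature) (V : variety tau) : Prop :=
  forall A : member V, nontrivial A -> ~ exists a : A, subuniverse [set a].

Definition congruence_modular (tau : signature) (V : variety tau) : Prop :=
  forall (A : member V) (a b c : Con A), a <= c -> a `|` (b `&` c) = (a `|` b) `&` c.

(* Semidegenerate congruence-modular varieties. *)
Record sdcm_variety (tau : signature) := SdcmVariety {
  sdcm_base :> variety tau;
  sdcm_semidegenerate : semidegenerate sdcm_base;
  sdcm_modular : congruence_modular sdcm_base
}.

Section Commutator.
Context {tau : signature} (V : variety tau).

Definition con_operation := forall A : member V, Con A -> Con A -> Con A.

Definition commutator_conditions (C : con_operation) : Prop :=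
  forall (A B : member V) (f : epi A B) (a b : Con A),
    C A a b <= a `&` b /\
    C A a b `|` con_ker f = con_preim f (C B (con_image f a) (con_image f b)).

(* The pointwise join of all operations satisfying the conditions; it satisfies
   them itself (commutator_greatest), so it is the greatest one. *)
Definition commutator (A : member V) (a b : Con A) : Con A :=
  con_sup [set g | exists2 C, commutator_conditions C & g = C A a b].

Lemma commutator_conditions_bot : commutator_conditions (fun A _ _ => \bot).
Proof. by move=> A B f a b; split; [exact: le0x|rewrite join0x]. Qed.

Theorem commutator_greatest :
  commutator_conditions commutator /\
  forall C, commutator_conditions C ->
    forall (A : member V) (a b : Con A), C A a b <= commutator a b.
Proof.
split; last by move=> C hC A a b; apply: con_sup_ub; exists C.
move=> A B f a b; split.
  by apply/con_sup_le => _ [C hC ->]; case: (hC A B f a b).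
apply/eqP; rewrite eq_le leUx; apply/andP; split; first (apply/andP; split).
- apply/con_sup_le => _ [C hC ->].
  have [_ e] := hC A B f a b.
  have: C A a b <= C A a b `|` con_ker f by exact: leUl.
  move=> /le_trans; apply; rewrite e.
  apply/leConP => x y h /=.
  have /leConP : C B (con_image f a) (con_image f b) <=
    commutator (con_image f a) (con_image f b) by apply: con_sup_ub; exists C.
  by apply.
- apply/leConP => x y /con_kerE h; change (commutator (con_image f a) (con_image f b) (f x) (f y)).
  rewrite h; exact: con_refl.
- set g := _ `|` _.
  have -> : g = con_preim f (con_image f (commutator a b)) by rewrite con_preim_image.
  apply/leConP => x y; rewrite /con_preim /=.
  have /leConP : commutator (con_image f a) (con_image f b) <=
      con_image f (commutator a b); last by exact.
  apply/con_sup_le => _ [C hC ->].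
  have [_ e] := hC A B f a b.
  have: con_preim f (C B (con_image f a) (con_image f b)) <= g.
    rewrite -e leUx leUr andbT (le_trans _ (leUl _ _))//.
    by apply: con_sup_ub; exists C.
  rewrite /g -con_preim_image => /leConP h.
  apply/leConP => u v.
  have [u' <-] := epi_surj f u; have [v' <-] := epi_surj f v.
  exact: h.
Qed.

Program Definition id_epi (A : algebra tau) : epi A A := @Epi tau A A id _ _.
Next Obligation. by []. Qed.
Next Obligation. by move=> A b; exists b. Qed.

Lemma commutator_le (A : member V) (a b : Con A) : commutator a b <= a `&` b.
Proof. by have [h _] := commutator_greatest; case: (h A A (id_epi A) a b). Qed.

End Commutator.

Arguments commutator {tau V A} a b.

Section Spectrum.
Context {tau : signature} {V : sdcm_variety tau} (A : member V).
Implicit Types a b t : Con A.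

Definition prime_con : set (Con A) :=
  [set p | p != \top /\
           forall a b, commutator a b <= p -> a <= p \/ b <= p].

Definition SpecZ : Type := set_type prime_con.
HB.instance Definition _ := Choice.on SpecZ.

Definition spec_val (p : SpecZ) : Con A := set_val p.

Definition spec_D t : set SpecZ := [set p | ~ t <= spec_val p].

Definition spec_op : set_system SpecZ := [set U | exists t, U = spec_D t].

Lemma primeP p a b : prime_con p -> (commutator a b <= p) <-> (a <= p \/ b <= p).
Proof.
move=> [_ h]; split; first exact: h.
have := commutator_le a b; rewrite lexI => /andP[ha hb].
by case=> k; [exact: le_trans ha k|exact: le_trans hb k].
Qed.

Lemma spec_valP (p : SpecZ) : prime_con (spec_val p).
Proof. exact: set_valP. Qed.

Lemma spec_opT : spec_op setT.
Proof.
exists \top; apply/esym/seteqP; split=> // p _ /=.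
by have [/negP k _] := spec_valP p => h; apply: k; rewrite -le1x.
Qed.

Lemma spec_opI : setI_closed spec_op.
Proof.
move=> _ _ [a ->] [b ->]; exists (commutator a b).
apply/seteqP; split=> p /=.
  by move=> [ha hb] /(primeP _ _ (spec_valP p))[].
by move=> h; split=> k; apply: h; apply/(primeP _ _ (spec_valP p)); [left|right].
Qed.

Lemma spec_op_bigU (I : Type) (f : I -> set SpecZ) :
  (forall i, spec_op (f i)) -> spec_op (\bigcup_i f i).
Proof.
move=> h; exists (con_sup [set t | exists i, f i = spec_D t]).
apply/seteqP; split=> p /=.
  move=> [i _]; have [t e] := h i; rewrite e => tp /con_sup_le k.
  by apply: tp; apply: k; exists i.
move=> tp; apply: contrapT => hn; apply: tp; apply/con_sup_le => t [i e].
by apply: contrapT => tp; apply: hn; exists i => //; rewrite e.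
Qed.

HB.instance Definition _ :=
  isOpenTopological.Build SpecZ spec_opT spec_opI spec_op_bigU.

Lemma spec_openE (U : set SpecZ) : open U <-> exists t, U = spec_D t.
Proof. by []. Qed.

Definition rho t : Con A := con_inf [set p | prime_con p /\ t <= p].

Lemma le_rho p t : prime_con p -> (rho t <= p) = (t <= p).
Proof.
move=> pp; apply/idP/idP => [|tp].
  by apply: le_trans; apply/leConP => x y txy q [_ /leConP]; exact.
by apply/leConP => x y; apply; split.
Qed.

Lemma rhoP a b :
  rho a = rho b <-> forall p, prime_con p -> (a <= p) = (b <= p).
Proof.
split=> [e p pp|h]; first by rewrite -le_rho// e le_rho.
congr con_inf; apply/seteqP.
by split=> p [pp k]; split=> //; [rewrite -h|rewrite h].
Qed.

End Spectrum.

Section Reticulation.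
Context {tau : signature} {V : sdcm_variety tau} (A : member V).

(* The least set of congruences containing the compact ones and closed under
   binary joins and commutators. *)
Inductive in_C : Con A -> Prop :=
| in_C_compact a : compact_con a -> in_C a
| in_C_join a b : in_C a -> in_C b -> in_C (a `|` b)
| in_C_commutator a b : in_C a -> in_C b -> in_C (commutator a b).

Definition CA : set (Con A) := [set a | in_C a].

Lemma Delta_compact : @compact_con tau A \bot.
Proof.
exists set0; first exact: finite_set0.
by apply/eqP; rewrite eq_le le0x; apply/con_gen_le => x y.
Qed.

Lemma Nabla_compact : @compact_con tau A \top.
Proof.
have [a0] := carrier_inhabited A.
pose X : set (A * A) := range (fun s : sym tau => (a0, op A s (fun=> a0))).
exists X; first by apply: finite_image; exact: finite_finset.
set t := con_gen X; apply/eqP; rewrite eq_le lex1 andbT.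
pose Q : member V := Member (variety_H (quo_fun_hom t) (@quo_fun_surj _ _ t) (memberP A)).
apply/leConP => x y _; apply: contrapT => txy.
have nQ : nontrivial Q.
  by exists (quo_fun t x), (quo_fun t y) => /quo_funP.
apply: (sdcm_semidegenerate nQ); exists (quo_fun t a0) => s z hz /=.
have -> : z = quo_fun t \o (fun=> a0) by apply/funext => i; exact: hz.
apply: etrans (esym (@quo_fun_hom _ _ t s (fun=> a0))) _; apply/quo_funP; apply: con_sym => b hb.
by apply: hb; exists s.
Qed.

Definition CA_bot : CA := SigSub (mem_set (in_C_compact Delta_compact)).
Definition CA_top : CA := SigSub (mem_set (in_C_compact Nabla_compact)).
Definition CA_join (a b : CA) : CA :=
  SigSub (mem_set (in_C_join (set_valP a) (set_valP b))).
Definition CA_commutator (a b : CA) : CA :=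
  SigSub (mem_set (in_C_commutator (set_valP a) (set_valP b))).

Definition CA_equiv : rel CA := fun a b => rho (set_val a) == rho (set_val b).

Lemma CA_equiv_refl : reflexive CA_equiv.
Proof. by move=> a; exact: eqxx. Qed.
Lemma CA_equiv_sym : symmetric CA_equiv.
Proof. by move=> a b; exact: eq_sym. Qed.
Lemma CA_equiv_trans : transitive CA_equiv.
Proof. by move=> b a c /eqP + /eqP; rewrite /CA_equiv => -> ->. Qed.

Canonical CA_equivRel :=
  EquivRel CA_equiv CA_equiv_refl CA_equiv_sym CA_equiv_trans.

(* The reticulation: C(A) modulo equality of radicals, with join induced by the
   join and meet induced by the commutator (lambda_join, lambda_commutator). *)
Definition L : Type := {eq_quot CA_equivRel}.
HB.instance Definition _ := EqQuotient.on L.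
HB.instance Definition _ := Choice.on L.

Definition lambda (a : CA) : L := (\pi_L a)%qT.

Lemma lambdaP a b : lambda a = lambda b <->
  forall p, prime_con p -> (set_val a <= p) = (set_val b <= p).
Proof.
rewrite -rhoP; split=> [/eqmodP/eqP//|h].
by apply/eqmodP/eqP.
Qed.

Lemma lambda_surj (x : L) : exists a, lambda a = x.
Proof. by exists (repr x); exact: reprK. Qed.

Definition L_join (x y : L) : L := lambda (CA_join (repr x) (repr y)).
Definition L_meet (x y : L) : L := lambda (CA_commutator (repr x) (repr y)).

Lemma CA_joinE p (a b : CA) :
  (set_val (CA_join a b) <= p) = (set_val a <= p) && (set_val b <= p).
Proof. exact: leUx. Qed.

Lemma CA_commutatorE p (a b : CA) : prime_con p ->
  (set_val (CA_commutator a b) <= p) = (set_val a <= p) || (set_val b <= p).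
Proof.
by move=> pp; apply/idP/orP => /(primeP _ _ pp).
Qed.

Lemma repr_lambda p (a : CA) : prime_con p ->
  (set_val (repr (lambda a)) <= p) = (set_val a <= p).
Proof.
have /lambdaP h : lambda (repr (lambda a)) = lambda a by exact: reprK.
exact: h.
Qed.

Lemma lambda_join a b : lambda (CA_join a b) = L_join (lambda a) (lambda b).
Proof. by apply/lambdaP => p pp; rewrite !CA_joinE !repr_lambda. Qed.

Lemma lambda_commutator a b :
  lambda (CA_commutator a b) = L_meet (lambda a) (lambda b).
Proof. by apply/lambdaP => p pp; rewrite !CA_commutatorE// !repr_lambda. Qed.

Ltac solve_L := repeat (let x := fresh in move=> x; have [? <-] := lambda_surj x);
  rewrite -?(lambda_join, lambda_commutator); apply/lambdaP => ? ?;
  rewrite ?(CA_joinE, CA_commutatorE)//; do ?case: (set_val _ <= _) => //.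

Lemma L_meetC : commutative L_meet. Proof. by solve_L. Qed.
Lemma L_joinC : commutative L_join. Proof. by solve_L. Qed.
Lemma L_meetA : associative L_meet. Proof. by solve_L. Qed.
Lemma L_joinA : associative L_join. Proof. by solve_L. Qed.
Lemma L_joinKI y x : L_meet x (L_join x y) = x.
Proof. by move: y x; solve_L. Qed.
Lemma L_meetKU y x : L_join x (L_meet x y) = x.
Proof. by move: y x; solve_L. Qed.
Lemma L_meetUl : left_distributive L_meet L_join. Proof. by solve_L. Qed.
Lemma L_meetxx : idempotent_op L_meet. Proof. by solve_L. Qed.

Fact L_display : Order.disp_t. Proof. exact: Order.Disp tt tt. Qed.

HB.instance Definition _ := Order.isMeetJoinDistrLattice.Build L_display L
  (fun _ _ => erefl) (fun _ _ => erefl)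
  L_meetC L_joinC L_meetA L_joinA L_joinKI L_meetKU L_meetUl L_meetxx.

Lemma L_le0x (x : L) : lambda CA_bot <= x.
Proof.
have [a <-] := lambda_surj x; apply/eqP; change (L_meet (lambda CA_bot) (lambda a) = lambda CA_bot).
by rewrite -lambda_commutator; apply/lambdaP => p pp; rewrite CA_commutatorE//= le0x.
Qed.

Lemma L_lex1 (x : L) : x <= lambda CA_top.
Proof.
have [a <-] := lambda_surj x; apply/eqP; change (L_meet (lambda a) (lambda CA_top) = lambda a).
rewrite -lambda_commutator; apply/lambdaP => p pp; rewrite CA_commutatorE//=.
case: (boolP (set_val a <= p)) => //= _; rewrite le1x.
by case: pp => /negbTE ->.
Qed.

HB.instance Definition _ := Order.hasBottom.Build L_display L L_le0x.
HB.instance Definition _ := Order.hasTop.Build L_display L L_lex1.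

End Reticulation.

Arguments CA {tau V} A.

Section Ideals.
Context {d : Order.disp_t} {T : tbDistrLatticeType d}.

Definition ideal (I : set T) : Prop :=
  [/\ I \bot,
      forall x y, x <= y -> I y -> I x &
      forall x y, I x -> I y -> I (x `|` y)].

Definition prime_ideal : set (set T) :=
  [set P | [/\ ideal P, P != setT & forall x y, P (x `&` y) -> P x \/ P y]].

End Ideals.

Section IdealSpectrum.
Context {d : Order.disp_t} (T : tbDistrLatticeType d).

Definition SpecIdZ : Type := set_type (@prime_ideal d T).
HB.instance Definition _ := Choice.on SpecIdZ.

Definition specId_val (P : SpecIdZ) : set T := set_val P.

Definition specId_D (I : set T) : set SpecIdZ := [set P | ~ (I `<=` specId_val P)].

Definition specId_op : set_system SpecIdZ :=
  [set U | exists2 I, ideal I & U = specId_D I].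

Lemma specId_valP (P : SpecIdZ) : prime_ideal (specId_val P).
Proof. exact: set_valP. Qed.

Lemma specId_opT : specId_op setT.
Proof.
exists setT; first by split.
apply/esym/seteqP; split=> // P _ /= h.
have [_ /eqP k _] := specId_valP P; apply: k; apply/seteqP; split=> //.
Qed.

Lemma specId_opI : setI_closed specId_op.
Proof.
move=> _ _ [I [I0 Il Ij] ->] [J [J0 Jl Jj] ->]; exists (I `&` J).
  split; first by split.
  - by move=> x y xy [Iy Jy]; split; [exact: Il xy Iy|exact: Jl xy Jy].
  - by move=> x y [? ?] [? ?]; split; [exact: Ij|exact: Jj].
apply/seteqP; split=> P /=.
  have [[_ Pl _] _ hP] := specId_valP P.
  move=> [hI hJ] h; apply: hI => x Ix; apply: contrapT => Px.
  apply: hJ => y Jy.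
  have /h /hP[//|//] : (I `&` J) (x `&` y)%O.
  by split; [exact: Il (leIl _ _) Ix|exact: Jl (leIr _ _) Jy].
by move=> h; split=> k; apply: h => x [? ?]; exact: k.
Qed.

Lemma specId_op_bigU (I : Type) (f : I -> set SpecIdZ) :
  (forall i, specId_op (f i)) -> specId_op (\bigcup_i f i).
Proof.
move=> h.
pose F := [set J : set T | ideal J /\ exists i, f i = specId_D J].
pose K := [set x | forall J, ideal J -> (forall G, F G -> G `<=` J) -> J x].
have FK G : F G -> G `<=` K by move=> FG x Gx J _ h'; exact: (h' G).
have iK : ideal K.
  split.
  - by move=> J [].
  - move=> x y xy Ky J iJ FJ; have [_ Jl _] := iJ.
    by apply: Jl xy _; exact: Ky.
  - move=> x y Kx Ky J iJ FJ; have [_ _ Jj] := iJ.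
    by apply: Jj; [exact: Kx|exact: Ky].
exists K => //; apply/seteqP; split=> P /=.
  move=> [i _]; have [J iJ e] := h i; rewrite e => JP KP.
  by apply: JP; apply: subset_trans KP; apply: FK; split=> //; exists i.
move=> KP; apply: contrapT => hn; apply: KP => x; apply.
  by case: (specId_valP P).
move=> G [_ [i e]]; apply: contrapT => GP; apply: hn; exists i => //.
by rewrite e.
Qed.

HB.instance Definition _ :=
  isOpenTopological.Build SpecIdZ specId_opT specId_opI specId_op_bigU.

Lemma specId_openE (U : set SpecIdZ) :
  open U <-> exists2 I, ideal I & U = specId_D I.
Proof. by []. Qed.

End IdealSpectrum.

Section Star.
Context {tau : signature} {V : sdcm_variety tau} {A : member V}.

(* t^* *)
Definition upper_star (t : Con A) : set (L A) :=
  [set lambda a | a in [set a : CA A | set_val a <= t]].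

Definition compact_CA (a : Con A) (ca : compact_con a) : CA A :=
  SigSub (mem_set (in_C_compact ca)).

(* I_* *)
Definition lower_star (I : set (L A)) : Con A :=
  con_sup [set a | exists ca : compact_con a, I (lambda (compact_CA ca))].

End Star.

(* Main.v *)
Require Import Defs.
From HB Require Import structures.
From mathcomp Require Import all_boot all_order.
From mathcomp Require Import boolp classical_sets functions cardinality.
From mathcomp Require Import topology.

(** A congruence is the join of the principal congruences below it, so
    [t = lower_star (upper_star t)], while the hypothesis is the other identity
    [I = upper_star (lower_star I)].  The hypothesis also makes [lower_star P]
    prime: if [a] and [b] are principal, not below [lower_star P], and their
    commutator is, then its class lies in [upper_star (lower_star P) = P], so the
    class of [a] or of [b] lies in [P].  The reduction to principal congruences
    needs the commutator to be monotone.  This follows from its maximality,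
    because by modularity the monotone closure of an operation satisfying the
    commutator conditions satisfies them again. *)

Set Implicit Arguments.
Unset Strict Implicit.
Unset Printing Implicit Defensive.

Import Order.TTheory.

Section CommutatorMonotone.
Local Open Scope classical_set_scope.
Local Open Scope order_scope.
Context {tau : signature}.

Lemma con_preim_le (A B : algebra tau) (f : epi A B) (b b' : Con B) :
  b <= b' -> con_preim f b <= con_preim f b'.
Proof. by move=> /leConP h; apply/leConP => x y; exact: h. Qed.

Lemma con_image_mono (A B : algebra tau) (f : epi A B) (a a' : Con A) :
  a <= a' -> con_image f a <= con_image f a'.
Proof.
by move=> h; rewrite con_image_le con_preim_image (le_trans h (leUl _ _)).
Qed.

Lemma con_ker_le_preim (A B : algebra tau) (f : epi A B) (b : Con B) :
  con_ker f <= con_preim f b.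
Proof. exact/con_preim_le/le0x. Qed.

Lemma con_image_preim (A B : algebra tau) (f : epi A B) (b : Con B) :
  con_image f (con_preim f b) = b.
Proof. by apply: le_anti; rewrite con_image_le lexx le_con_image. Qed.

(** Lifts a congruence below the image of [a] to one below [a]. After pulling back along [f], the
    modular law applies because [con_ker f] lies below [con_preim f b]. *)
Lemma con_image_meet_preim (V : sdcm_variety tau) (A B : member V)
    (f : epi A B) (a : Con A) (b : Con B) :
  b <= con_image f a -> con_image f (a `&` con_preim f b) = b.
Proof.
move=> hb.
have -> : con_image f (a `&` con_preim f b) =
    con_image f (con_preim f (con_image f (a `&` con_preim f b))).
  by rewrite con_image_preim.
rewrite con_preim_image joinC sdcm_modular; last exact: con_ker_le_preim.
rewrite joinC -con_preim_image.
by rewrite (meet_r (con_preim_le f hb)) con_image_preim.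
Qed.

Definition monotone_closure (V : variety tau) (C : con_operation V) :
    con_operation V :=
  fun A a b => con_sup [set g | exists a' b', [/\ a' <= a, b' <= b & g = C A a' b']].

Lemma le_monotone_closure (V : variety tau) (C : con_operation V)
    (A : member V) (a b a' b' : Con A) :
  a' <= a -> b' <= b -> C A a' b' <= monotone_closure C a b.
Proof. by move=> ha hb; apply: con_sup_ub; exists a', b'. Qed.

Lemma commutator_conditions_monotone_closure (V : sdcm_variety tau)
    (C : con_operation V) :
  commutator_conditions C -> commutator_conditions (monotone_closure C).
Proof.
move=> hC A B f a b; split.
  apply/con_sup_le => _ [a' [b' [ha hb ->]]].
  have [h _] := hC A A (id_epi A) a' b'.
  exact: le_trans h (leI2 ha hb).
apply: le_anti; rewrite leUx con_ker_le_preim andbT; apply/andP; split.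
  apply/con_sup_le => _ [a' [b' [ha hb ->]]].
  have [_ e] := hC A B f a' b'.
  apply: le_trans (leUl _ (con_ker f)) _; rewrite e.
  by apply: con_preim_le; apply: le_monotone_closure; exact: con_image_mono.
rewrite -con_preim_image; apply: con_preim_le.
apply/con_sup_le => _ [u [v [hu hv ->]]].
rewrite -[C B u v](con_image_preim f) con_image_le con_preim_image.
(* These lifts lie below [a] and [b] and have images [u] and [v], so the condition for [C] at them
   describes the preimage of [C B u v]. *)
have [_ e] := hC A B f (a `&` con_preim f u) (b `&` con_preim f v).
move: e; rewrite !con_image_meet_preim// => <-; apply: leU2 => //.
by apply: le_monotone_closure; exact: leIl.
Qed.

Lemma commutator_mono (V : sdcm_variety tau) (A : member V) (a b a' b' : Con A) :
  a' <= a -> b' <= b -> commutator a' b' <= commutator a b.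
Proof.
move=> ha hb; have [hC max] := commutator_greatest V.
apply: le_trans (max _ (commutator_conditions_monotone_closure hC) A a b).
exact: (le_monotone_closure (@commutator tau V)).
Qed.

End CommutatorMonotone.

Section Stars.
Local Open Scope classical_set_scope.
Local Open Scope order_scope.
Context {tau : signature}.

(** Each pair in [a] generates a principal, hence compact, congruence below [a]. *)
Lemma le_compact (A : algebra tau) (a t : Con A) :
  (forall c, compact_con c -> c <= a -> c <= t) -> a <= t.
Proof.
move=> h; apply/leConP => x y axy.
have /h : compact_con (con_gen [set (x, y)]).
  by exists [set (x, y)] => //; exact: finite_set1.
move=> /(_ _)/con_gen_le; apply => //.
by apply/con_gen_le => _ _ [-> ->].
Qed.

Context {V : sdcm_variety tau} {A : member V}.
Implicit Types (t p : Con A) (I P : set (L A)).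

Lemma upper_star_mono t t' : t <= t' -> upper_star t `<=` upper_star t'.
Proof. by move=> h _ [a /= ha <-]; exists a => //=; exact: le_trans h. Qed.

Lemma lower_star_mono I J : I `<=` J -> lower_star I <= lower_star J.
Proof.
move=> IJ; apply/con_sup_le => a [ca Ia].
by apply: con_sup_ub; exists ca; exact: IJ.
Qed.

Lemma le_lower_star I (a : Con A) (ca : compact_con a) :
  I (lambda (compact_CA ca)) -> a <= lower_star I.
Proof. by move=> Ia; apply: con_sup_ub; exists ca. Qed.

Lemma le_lower_upper_star t : t <= lower_star (upper_star t).
Proof.
apply: le_compact => c cc ct; apply: (@le_lower_star _ c cc).
by exists (compact_CA cc).
Qed.

Lemma ideal_upper_star t : ideal (upper_star t).
Proof.
split.
- by exists (CA_bot A) => //=; exact: le0x.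
- move=> x y xy [b bt eb]; move: xy; rewrite -eb; have [a <-] := lambda_surj x.
  move=> /meet_idPl e.
  (* [a] itself need not lie below [t]; its commutator with [b] does, and has the same class because
     [lambda a] is below [lambda b]. *)
  exists (CA_commutator a b); last by rewrite lambda_commutator; exact: e.
  apply: le_trans bt => /=.
  exact: le_trans (commutator_le _ _) (leIr _ _).
- move=> _ _ [a at_ <-] [b bt <-]; exists (CA_join a b); last exact: lambda_join.
  by rewrite /= CA_joinE at_ bt.
Qed.

(** Equivalent members of [CA A] lie below the same primes, so any representative of a class can be
    tested. *)
Lemma upper_star_lambda p (a : CA A) : prime_con p ->
  upper_star p (lambda a) <-> set_val a <= p.
Proof.
move=> pp; split=> [[b bp /lambdaP e]|ap]; last by exists a.
by have <- := e p pp.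
Qed.

Lemma prime_upper_star p : prime_con p -> prime_ideal (upper_star p).
Proof.
move=> pp; split; first exact: ideal_upper_star.
- apply/eqP => e; have : upper_star p (lambda (CA_top A)) by rewrite e.
  move=> /(upper_star_lambda _ pp) /=; rewrite le1x => /eqP e'.
  by case: pp; rewrite e' eqxx.
- move=> x y; have [a <-] := lambda_surj x; have [b <-] := lambda_surj y.
  rewrite -[_ `&` _]lambda_commutator !(upper_star_lambda _ pp).
  by rewrite CA_commutatorE// => /orP.
Qed.

(** Classes record only radicals, so for a non-prime [t] in place of [p] the left side can be
    strictly larger than [t]. *)
Lemma lower_upper_star_prime p : prime_con p -> lower_star (upper_star p) = p.
Proof.
move=> pp; apply: le_anti; rewrite le_lower_upper_star andbT.
by apply/con_sup_le => a [ca /(upper_star_lambda _ pp)].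
Qed.

Lemma prime_lower_star P : P = upper_star (lower_star P) ->
  prime_ideal P -> prime_con (lower_star P).
Proof.
move=> eP [_ /eqP Ptop Pprime]; split.
  (* If [lower_star P] were the top, every representative would lie below it and [P] would contain
     every class. *)
  apply/eqP => e; apply: Ptop; rewrite eP e; apply/seteqP; split=> // x _.
  by have [a <-] := lambda_surj x; exists a => //=; exact: lex1.
move=> a b ab; apply: contrapT => /not_orP[na nb].
apply: na; apply: le_compact => c cc ca.
apply: contrapT => nc; apply: nb; apply: le_compact => d cd db.
have : P (lambda (compact_CA cc) `&` lambda (compact_CA cd)).
  rewrite -[_ `&` _]lambda_commutator eP.
  exists (CA_commutator (compact_CA cc) (compact_CA cd)) => //.
  exact: le_trans (commutator_mono ca db) ab.
by case/Pprime => /le_lower_star.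
Qed.

(** Continuity of [u]: the preimage of [specId_D I] is [spec_D (lower_star I)]. *)
Lemma subset_upper_star_prime I p : I = upper_star (lower_star I) ->
  prime_con p -> I `<=` upper_star p <-> lower_star I <= p.
Proof.
move=> eI pp; split=> [/lower_star_mono|h].
  by rewrite lower_upper_star_prime.
by rewrite eI; exact: upper_star_mono.
Qed.

(** Continuity of [v]: the preimage of [spec_D t] is [specId_D (upper_star t)]. *)
Lemma upper_star_subset t P : P = upper_star (lower_star P) ->
  upper_star t `<=` P <-> t <= lower_star P.
Proof.
move=> eP; split=> [/lower_star_mono|h].
  exact: le_trans (le_lower_upper_star t).
by rewrite eP; exact: upper_star_mono.
Qed.

End Stars.

Theorem proposition3p16 (tau : signature) (V : sdcm_variety tau) (A : member V)
    (hA : forall I : set (L A), ideal I -> I = upper_star (lower_star I)) :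
  exists (u : SpecZ A -> SpecIdZ (L A)) (v : SpecIdZ (L A) -> SpecZ A),
    (forall p : SpecZ A, specId_val (u p) = upper_star (spec_val p)) /\
    (forall P : SpecIdZ (L A), spec_val (v P) = lower_star (specId_val P)) /\
    cancel u v /\ cancel v u /\ continuous u /\ continuous v.
Proof.
have hP (P : SpecIdZ (L A)) :
    specId_val P = upper_star (lower_star (specId_val P)).
  by apply: hA; case: (specId_valP P).
pose u (p : SpecZ A) : SpecIdZ (L A) :=
  SigSub (mem_set (prime_upper_star (spec_valP p))).
pose v (P : SpecIdZ (L A)) : SpecZ A :=
  SigSub (mem_set (prime_lower_star (hP P) (specId_valP P))).
exists u, v; do !split=> //.
- by move=> p; apply: val_inj; exact: lower_upper_star_prime (spec_valP p).
- by move=> P; apply: val_inj; exact: esym (hP P).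
- apply/continuousP => _ [I iI ->]; exists (lower_star I).
  by apply/seteqP; split=> p /= np /(subset_upper_star_prime (hA I iI) (spec_valP p)).
- apply/continuousP => _ [t ->]; exists (upper_star t).
    exact: ideal_upper_star.
  by apply/seteqP; split=> P /= nP /(upper_star_subset t (hP P)).
Qed.
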